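(* For every set of formulas $\Gamma$ and every formula $\phi$: if $\Gamma\vDash_{\mathbf{SU}}\phi$ then $\Gamma\vdash_{\mathbf{SU}}\phi$.
   Context: Formulas are built from countably many propositional variables and $\bot$ with $\land,\lor,\to$; $\neg\alpha$ abbreviates $\alpha\to\bot$. $\vdash_{\mathbf{SU}}$ is the consequence relation of the Hilbert system for intuitionistic propositional logic (with modus ponens) extended by all substitution instances of $\boldsymbol{su} = ((\neg p\to q)\land(\neg q\to p) \rightarrow r \vee s) \to ( p \rightarrow r) \vee(q \rightarrow s)$ as axioms; $\Gamma\vdash_{\mathbf{SU}}\phi$ means $\phi$ is derivable from assumptions in $\Gamma$. For an $\mathbf{S4}$ frame $\langle W,R\rangle$ ($R$ reflexive and transitive) and $X\subseteq W$ put $\mathord{\uparrow}X=\{w:\exists x\in X,\ xRw\}$, $\Diamond X=\{w:\exists x\in X,\ wRx\}$, $\Box X=\{w:\forall v(wRv\Rightarrow v\in X)\}$. A point $z$ strongly unites $x_0,x_1$ if $zRx_0$, $zRx_1$, $z\in\Box(\mathord{\uparrow}\{x_0\}\cup\Diamond\mathord{\uparrow}\{x_1\})$ and $z\in\Box(\mathord{\uparrow}\{x_1\}\cup\Diamond\mathord{\uparrow}\{x_0\})$. The frame satisfies $(su_2)$ if for every $w$ and all $x_0,x_1$ with $wRx_0$, $wRx_1$ there is $z$ with $wRz$ strongly uniting $x_0,x_1$. $\Gamma\vDash_{\mathbf{SU}}\phi$ means: for every $\mathbf{S4}$ frame satisfying $(su_2)$, every upward-closed valuation and every point, if all formulas of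 $\Gamma$ are true at the point (intuitionistic Kripke semantics) then $\phi$ is true there. *)

(* Defs.v *)
From Stdlib Require Import Ensembles Relations.

Inductive formula : Set :=
| Var (n : nat)
| Bot
| And (a b : formula)
| Or (a b : formula)
| Imp (a b : formula).

Definition Neg (a : formula) : formula := Imp a Bot.

Fixpoint subst (sigma : nat -> formula) (a : formula) : formula :=
  match a with
  | Var n => sigma n
  | Bot => Bot
  | And b c => And (subst sigma b) (subst sigma c)
  | Or b c => Or (subst sigma b) (subst sigma c)
  | Imp b c => Imp (subst sigma b) (subst sigma c)
  end.

Definition su : formula :=
  let p := Var 0 in let q := Var 1 in let r := Var 2 in let s := Var 3 in
  Imp (Imp (And (Imp (Neg p) q) (Imp (Neg q) p)) (Or r s))
      (Or (Imp p r) (Imp q s)).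

Inductive ipc_axiom : formula -> Prop :=
| ax_k a b : ipc_axiom (Imp a (Imp b a))
| ax_s a b c :
    ipc_axiom (Imp (Imp a (Imp b c)) (Imp (Imp a b) (Imp a c)))
| ax_and_l a b : ipc_axiom (Imp (And a b) a)
| ax_and_r a b : ipc_axiom (Imp (And a b) b)
| ax_and_i a b : ipc_axiom (Imp a (Imp b (And a b)))
| ax_or_l a b : ipc_axiom (Imp a (Or a b))
| ax_or_r a b : ipc_axiom (Imp b (Or a b))
| ax_or_e a b c :
    ipc_axiom (Imp (Imp a c) (Imp (Imp b c) (Imp (Or a b) c)))
| ax_bot a : ipc_axiom (Imp Bot a).

Inductive SU_derives (Gamma : Ensemble formula) : formula -> Prop :=
| d_hyp a : In formula Gamma a -> SU_derives Gamma a
| d_ipc a : ipc_axiom a -> SU_derives Gamma a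
| d_su sigma : SU_derives Gamma (subst sigma su)
| d_mp a b :
    SU_derives Gamma (Imp a b) -> SU_derives Gamma a -> SU_derives Gamma b.

Record S4_frame : Type := {
  world : Type;
  acc : relation world;
  acc_refl : reflexive world acc;
  acc_trans : transitive world acc
}.

Definition up (F : S4_frame) (X : Ensemble (world F)) : Ensemble (world F) :=
  fun w => exists x, In (world F) X x /\ acc F x w.

Definition diamond (F : S4_frame) (X : Ensemble (world F))
  : Ensemble (world F) :=
  fun w => exists x, In (world F) X x /\ acc F w x.

Definition box (F : S4_frame) (X : Ensemble (world F)) : Ensemble (world F) :=
  fun w => forall v, acc F w v -> In (world F) X v.

Definition strongly_unites (F : S4_frame) (z x0 x1 : world F) : Prop :=
  let W := world F in
  acc F z x0 /\ acc F z x1 /\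
  In W (box F (Union W (up F (Singleton W x0))
                       (diamond F (up F (Singleton W x1))))) z /\
  In W (box F (Union W (up F (Singleton W x1))
                       (diamond F (up F (Singleton W x0))))) z.

Definition su2 (F : S4_frame) : Prop :=
  forall w x0 x1 : world F, acc F w x0 -> acc F w x1 ->
    exists z, acc F w z /\ strongly_unites F z x0 x1.

Definition upward_closed (F : S4_frame) (X : Ensemble (world F)) : Prop :=
  forall w v, In (world F) X w -> acc F w v -> In (world F) X v.

Fixpoint forces (F : S4_frame) (V : nat -> Ensemble (world F)) (w : world F)
  (a : formula) : Prop :=
  match a with
  | Var n => In (world F) (V n) w
  | Bot => False
  | And b c => forces F V w b /\ forces F V w c
  | Or b c => forces F V w b \/ forces F V w c
  | Imp b c => forall v, acc F w v -> forces F V v b -> forces F V v c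
  end.

Definition SU_entails (Gamma : Ensemble formula) (phi : formula) : Prop :=
  forall F : S4_frame, su2 F ->
  forall V : nat -> Ensemble (world F), (forall n, upward_closed F (V n)) ->
  forall w : world F,
    (forall a, In formula Gamma a -> forces F V w a) -> forces F V w phi.

(* Main.v *)
Require Import Defs.
From Stdlib Require Import Ensembles Relations Classical Arith Cantor.

(** The canonical model consists of the prime theories ordered by inclusion.
    To strongly unite [x] and [y] above [w], add to [w] every formula
    [(~p -> q) /\ (~q -> p)] with [p] in [x] and [q] in [y].  These formulas
    form a filter base, so by compactness the axiom [su] says exactly that no
    [r \/ s] with [r] outside [x] and [s] outside [y] becomes derivable.  Such
    disjunctions form an ideal base, and any prime theory [z] avoiding it lies
    below [x] and [y].  If a theory [v] above [z] is inconsistent with [y], then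
    it contains [~q] for some [q] in [y], hence all of [x]. *)

Notation theory := (Ensemble formula).
Notation extend := (Add formula).

Section Directed.

Context {A : Type}.

Definition directed (R : relation A) (X : Ensemble A) : Prop :=
  Inhabited A X /\
  forall a b, In A X a -> In A X b -> exists c, In A X c /\ R a c /\ R b c.

Lemma directed_singleton (R : relation A) (a : A) :
  reflexive A R -> directed R (Singleton A a).
Proof.
  intros HR. split.
  - exists a. constructor.
  - intros _ _ [] []. exists a. repeat split; apply HR.
Qed.

End Directed.

Inductive image2 {A B C : Type} (f : A -> B -> C) (X : Ensemble A)
  (Y : Ensemble B) : Ensemble C :=
| image2_intro a b : In A X a -> In B Y b -> image2 f X Y (f a b).

Lemma directed_image2 {A B C : Type} (RA : relation A) (RB : relation B)
  (RC : relation C) (f : A -> B -> C) (X : Ensemble A) (Y : Ensemble B) :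
  (forall a a' b b', RA a a' -> RB b b' -> RC (f a b) (f a' b')) ->
  directed RA X -> directed RB Y -> directed RC (image2 f X Y).
Proof.
  intros Hf [[a0 Ha0] HX] [[b0 Hb0] HY]. split.
  - exists (f a0 b0). now constructor.
  - intros _ _ [a b Ha Hb] [a' b' Ha' Hb'].
    destruct (HX a a' Ha Ha') as (a'' & Ha'' & Haa & Haa').
    destruct (HY b b' Hb Hb') as (b'' & Hb'' & Hbb & Hbb').
    exists (f a'' b''). repeat split; auto.
Qed.

Definition indexed_union {A I : Type} (X : Ensemble I) (F : I -> Ensemble A)
  : Ensemble A :=
  fun a => exists i, In I X i /\ In A (F i) a.

Section MaximalExtension.

Variables (A : Type) (code : A -> nat).
Hypothesis code_inj : forall a b, code a = code b -> a = b.

Variable P : Ensemble A -> Prop.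
Hypothesis P_antitone : forall X Y, Included A X Y -> P Y -> P X.
Hypothesis P_chain : forall F : nat -> Ensemble A,
  (forall m n, m <= n -> Included A (F m) (F n)) ->
  (forall n, P (F n)) -> P (indexed_union (Full_set nat) F).

Variable G : Ensemble A.

Fixpoint stage (n : nat) : Ensemble A :=
  match n with
  | 0 => G
  | S n => fun a => In A (stage n) a \/ code a = n /\ P (Add A (stage n) a)
  end.

Lemma stage_mono m n : m <= n -> Included A (stage m) (stage n).
Proof.
  induction 1 as [|n _ IH]; intros a Ha; [exact Ha|].
  left. apply IH, Ha.
Qed.

Lemma stage_preserves n : P G -> P (stage n).
Proof.
  intros HG.
  induction n as [|n IH]; [exact HG|].
  destruct (classic (exists a, code a = n /\ P (Add A (stage n) a)))
    as [(a & Ea & Ha)|Hno].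
  - revert Ha. apply P_antitone.
    intros b [Hb|[Eb _]]; [now left|].
    right. rewrite (code_inj b a) by congruence. constructor.
  - revert IH. apply P_antitone.
    intros b [Hb|Hb]; [exact Hb|].
    contradict Hno. now exists b.
Qed.

Lemma maximal_extension :
  P G ->
  exists M, Included A G M /\ P M /\ forall a, P (Add A M a) -> In A M a.
Proof.
  intros HG.
  exists (indexed_union (Full_set nat) stage).
  split; [|split].
  - intros a Ha. now exists 0.
  - apply P_chain; [exact stage_mono|].
    intros n. now apply stage_preserves.
  - intros a Ha. exists (S (code a)).
    split; [constructor|right; split; [reflexivity|]].
    revert Ha. apply P_antitone.
    intros b [b' Hb|b' Hb]; [left; now exists (code a)|now right].
Qed.

End MaximalExtension.

Fixpoint formula_code (a : formula) : nat :=
  match a with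
  | Var n => to_nat (0, n)
  | Bot => to_nat (1, 0)
  | And b c => to_nat (2, to_nat (formula_code b, formula_code c))
  | Or b c => to_nat (3, to_nat (formula_code b, formula_code c))
  | Imp b c => to_nat (4, to_nat (formula_code b, formula_code c))
  end.

Lemma to_nat_pair_inj m n m' n' :
  to_nat (m, n) = to_nat (m', n') -> m = m' /\ n = n'.
Proof. intros E%to_nat_inj. now injection E. Qed.

Lemma formula_code_inj a b : formula_code a = formula_code b -> a = b.
Proof.
  revert b.
  induction a; intros [n'| |b1 b2|b1 b2|b1 b2] E; cbn [formula_code] in E;
    apply to_nat_pair_inj in E; destruct E as [Etag E]; try discriminate Etag;
    try (apply to_nat_pair_inj in E; destruct E); f_equal; auto.
Qed.

Lemma derives_cut (G H : theory) a :
  Included formula H (SU_derives G) -> SU_derives H a -> SU_derives G a.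
Proof.
  intros HHG Ha.
  induction Ha as [a Ha|a Ha|sigma|a b _ IHab _ IHa].
  - apply HHG, Ha.
  - apply d_ipc, Ha.
  - apply d_su.
  - exact (d_mp _ _ _ IHab IHa).
Qed.

Lemma derives_mono (G H : theory) a :
  Included formula G H -> SU_derives G a -> SU_derives H a.
Proof. intros HGH. apply derives_cut. intros b Hb. apply d_hyp, HGH, Hb. Qed.

Lemma derives_extend (G : theory) a b :
  SU_derives G b -> SU_derives (extend G a) b.
Proof. apply derives_mono. intros c Hc. now left. Qed.

Lemma derives_last (G : theory) a : SU_derives (extend G a) a.
Proof. apply d_hyp. right. constructor. Qed.

Lemma derives_const (G : theory) a b :
  SU_derives G b -> SU_derives G (Imp a b).
Proof. apply d_mp, d_ipc, ax_k. Qed.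

Lemma derives_id (G : theory) a : SU_derives G (Imp a a).
Proof.
  apply (d_mp _ (Imp a (Imp a a))).
  - apply (d_mp _ (Imp a (Imp (Imp a a) a))); apply d_ipc; constructor.
  - apply d_ipc. constructor.
Qed.

Lemma deduction (G : theory) a b :
  SU_derives (extend G a) b -> SU_derives G (Imp a b).
Proof.
  intros Hb.
  induction Hb as [b [c Hc|c Hc]|b Hb|sigma|b c _ IHbc _ IHb].
  - apply derives_const, d_hyp, Hc.
  - destruct Hc. apply derives_id.
  - apply derives_const, d_ipc, Hb.
  - apply derives_const, d_su.
  - exact (d_mp _ _ _ (d_mp _ _ _ (d_ipc _ _ (ax_s a b c)) IHbc) IHb).
Qed.

Lemma derives_and (G : theory) a b :
  SU_derives G (And a b) <-> SU_derives G a /\ SU_derives G b.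
Proof.
  split.
  - intros Hab. split; revert Hab; apply d_mp, d_ipc; constructor.
  - intros [Ha Hb].
    exact (d_mp _ _ _ (d_mp _ _ _ (d_ipc _ _ (ax_and_i a b)) Ha) Hb).
Qed.

Lemma derives_or_l (G : theory) a b : SU_derives G a -> SU_derives G (Or a b).
Proof. apply d_mp, d_ipc, ax_or_l. Qed.

Lemma derives_or_r (G : theory) a b : SU_derives G b -> SU_derives G (Or a b).
Proof. apply d_mp, d_ipc, ax_or_r. Qed.

Lemma derives_or_elim (G : theory) a b c :
  SU_derives G (Or a b) -> SU_derives (extend G a) c ->
  SU_derives (extend G b) c -> SU_derives G c.
Proof.
  intros Hab Ha%deduction Hb%deduction.
  refine (d_mp _ _ _ (d_mp _ _ _ (d_mp _ _ _ (d_ipc _ _ _) Ha) Hb) Hab).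
  constructor.
Qed.

Lemma derives_absurd (G : theory) a : SU_derives G Bot -> SU_derives G a.
Proof. apply d_mp, d_ipc, ax_bot. Qed.

Definition entails (a b : formula) : Prop :=
  SU_derives (Singleton formula a) b.

Lemma derives_entails (G : theory) a b :
  entails a b -> SU_derives G a -> SU_derives G b.
Proof. intros Hab Ha. revert Hab. apply derives_cut. now intros _ []. Qed.

Lemma entails_refl : reflexive formula entails.
Proof. intros a. apply d_hyp. constructor. Qed.

Lemma entails_and a a' b b' :
  entails a a' -> entails b b' -> entails (And a b) (And a' b').
Proof.
  intros Ha Hb.
  destruct (proj1 (derives_and _ a b) (entails_refl _)) as [Hl Hr].
  apply derives_and. split.
  - exact (derives_entails _ _ _ Ha Hl).
  - exact (derives_entails _ _ _ Hb Hr).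
Qed.

Lemma entails_or a a' b b' :
  entails a a' -> entails b b' -> entails (Or a b) (Or a' b').
Proof.
  intros Ha Hb. apply (derives_or_elim _ a b); [apply entails_refl| |].
  - apply derives_or_l, (derives_entails _ _ _ Ha), derives_last.
  - apply derives_or_r, (derives_entails _ _ _ Hb), derives_last.
Qed.

Lemma entails_imp a a' b b' :
  entails a' a -> entails b b' -> entails (Imp a b) (Imp a' b').
Proof.
  intros Ha Hb.
  apply deduction, (derives_entails _ _ _ Hb), (d_mp _ a).
  - apply derives_extend, entails_refl.
  - apply (derives_entails _ _ _ Ha), derives_last.
Qed.

Definition uniting (p q : formula) : formula :=
  And (Imp (Neg p) q) (Imp (Neg q) p).

Lemma entails_uniting p p' q q' :
  entails p p' -> entails q q' -> entails (uniting p q) (uniting p' q').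
Proof.
  intros Hp Hq.
  apply entails_and; apply entails_imp; trivial;
    apply entails_imp; trivial; apply entails_refl.
Qed.

Lemma derives_su_rule (G : theory) p q r s :
  SU_derives (extend G (uniting p q)) (Or r s) ->
  SU_derives G (Or (Imp p r) (Imp q s)).
Proof.
  intros Hrs%deduction. revert Hrs. apply d_mp.
  exact (d_su G (fun n => match n with 0 => p | 1 => q | 2 => r | _ => s end)).
Qed.

Lemma derives_directed_union {I : Type} (R : relation I) (X : Ensemble I)
  (F : I -> theory) a :
  directed R X -> (forall i j, R i j -> Included formula (F i) (F j)) ->
  SU_derives (indexed_union X F) a ->
  exists i, In I X i /\ SU_derives (F i) a.
Proof.
  intros [[i0 Hi0] HX] HF Ha.
  induction Ha as [a (i & Hi & Ha)|a Ha|sigma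
                  |a b _ (i & Hi & Hab) _ (j & Hj & Ha)].
  - exists i. split; [exact Hi|]. now apply d_hyp.
  - exists i0. split; [exact Hi0|]. now apply d_ipc.
  - exists i0. split; [exact Hi0|]. apply d_su.
  - destruct (HX i j Hi Hj) as (k & Hk & Hik & Hjk).
    exists k. split; [exact Hk|]. apply (d_mp _ a).
    + revert Hab. apply derives_mono, HF, Hik.
    + revert Ha. apply derives_mono, HF, Hjk.
Qed.

(* The deductive closures of [G] with one element of [X] form a directed family
   whose union contains [G] and [X]. *)
Lemma derives_filter_base (G X : theory) a :
  directed (transp formula entails) X -> SU_derives (Union formula G X) a ->
  exists p, In formula X p /\ SU_derives (extend G p) a.
Proof.
  intros HX Ha.
  destruct (derives_directed_union (transp formula entails) X
              (fun p => SU_derives (extend G p)) a HX) as (p & Hp & Hpa).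
  - intros p q Hqp b. apply derives_cut.
    intros c [c' Hc|c' []].
    + now apply derives_extend, d_hyp.
    + apply (derives_entails _ _ _ Hqp), derives_last.
  - destruct HX as [[p Hp] _]. revert Ha. apply derives_mono.
    intros b [b' Hb|b' Hb].
    + exists p. split; [exact Hp|]. now apply derives_extend, d_hyp.
    + exists b'. split; [exact Hb|apply derives_last].
  - exists p. split; [exact Hp|].
    revert Hpa. apply derives_cut. now intros b.
Qed.

Record prime_theory : Type := {
  prime_carrier :> theory;
  prime_closed a : SU_derives prime_carrier a -> In formula prime_carrier a;
  prime_disjunction a b :
    In formula prime_carrier (Or a b) ->
    In formula prime_carrier a \/ In formula prime_carrier b;
  prime_consistent : ~ In formula prime_carrier Bot
}.

Lemma prime_mem (T : prime_theory) a : In formula T a <-> SU_derives T a.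
Proof. split; [apply d_hyp|apply prime_closed]. Qed.

Definition avoids (T D : theory) : Prop :=
  forall d, In formula D d -> ~ SU_derives T d.

Definition maximal_avoiding (T D : theory) : Prop :=
  avoids T D /\ forall a, avoids (extend T a) D -> In formula T a.

Lemma avoids_antitone (D G H : theory) :
  Included formula G H -> avoids H D -> avoids G D.
Proof.
  intros HGH HH d Hd Hder. apply (HH d Hd). revert Hder.
  now apply derives_mono.
Qed.

Lemma avoids_chain (D : theory) (F : nat -> theory) :
  (forall m n, m <= n -> Included formula (F m) (F n)) ->
  (forall n, avoids (F n) D) -> avoids (indexed_union (Full_set nat) F) D.
Proof.
  intros Hmono HF d Hd Hder.
  destruct (derives_directed_union le (Full_set nat) F d) as (n & _ & Hn);
    trivial.
  - split; [now exists 0|].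
    intros m n _ _. exists (max m n).
    split; [constructor|split; [apply Nat.le_max_l|apply Nat.le_max_r]].
  - exact (HF n d Hd Hn).
Qed.

Lemma maximal_avoiding_extension (G D : theory) :
  avoids G D -> exists T, Included formula G T /\ maximal_avoiding T D.
Proof.
  exact (maximal_extension formula formula_code formula_code_inj
           (fun T => avoids T D) (avoids_antitone D) (avoids_chain D) G).
Qed.

Lemma maximal_avoiding_closed (T D : theory) a :
  maximal_avoiding T D -> SU_derives T a -> In formula T a.
Proof.
  intros [Hav Hmax] Ha. apply Hmax.
  intros d Hd Hder. apply (Hav d Hd).
  revert Hder. apply derives_cut.
  intros b [b' Hb|b' []]; [now apply d_hyp|exact Ha].
Qed.

Lemma maximal_avoiding_notin (T D : theory) a :
  maximal_avoiding T D -> ~ In formula T a ->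
  exists d, In formula D d /\ SU_derives (extend T a) d.
Proof.
  intros [_ Hmax] Ha. apply NNPP. intros Hno.
  apply Ha, Hmax. intros d Hd Hder. apply Hno. now exists d.
Qed.

Lemma maximal_avoiding_disjunction (T D : theory) a b :
  directed entails D -> maximal_avoiding T D -> In formula T (Or a b) ->
  In formula T a \/ In formula T b.
Proof.
  intros [_ HD] HT Hab.
  apply NNPP. intros [Ha Hb]%not_or_and.
  destruct (maximal_avoiding_notin _ _ _ HT Ha) as (d & Hd & Had).
  destruct (maximal_avoiding_notin _ _ _ HT Hb) as (e & He & Hbe).
  destruct (HD d e Hd He) as (c & Hc & Hdc & Hec).
  apply (proj1 HT c Hc), (derives_or_elim _ a b).
  - apply d_hyp, Hab.
  - exact (derives_entails _ _ _ Hdc Had).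
  - exact (derives_entails _ _ _ Hec Hbe).
Qed.

Lemma maximal_avoiding_consistent (T D : theory) :
  Inhabited formula D -> maximal_avoiding T D -> ~ In formula T Bot.
Proof.
  intros [d Hd] [Hav _] Hbot. apply (Hav d Hd), derives_absurd, d_hyp, Hbot.
Qed.

Lemma prime_extension (G D : theory) :
  directed entails D -> avoids G D ->
  exists T : prime_theory, Included formula G T /\ avoids T D.
Proof.
  intros HD HG.
  destruct (maximal_avoiding_extension G D HG) as (T & HGT & HT).
  exists {|
    prime_carrier := T;
    prime_closed a := maximal_avoiding_closed T D a HT;
    prime_disjunction a b := maximal_avoiding_disjunction T D a b HD HT;
    prime_consistent := maximal_avoiding_consistent T D (proj1 HD) HT
  |}.
  split; [exact HGT|apply HT].
Qed.

Lemma prime_extension_formula (G : theory) a :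
  ~ SU_derives G a ->
  exists T : prime_theory, Included formula G T /\ ~ In formula T a.
Proof.
  intros Ha.
  destruct (prime_extension G (Singleton formula a)) as (T & HGT & HT).
  - apply directed_singleton, entails_refl.
  - intros _ []. exact Ha.
  - exists T. split; [exact HGT|]. rewrite prime_mem. apply HT. constructor.
Qed.

Lemma prime_and (T : prime_theory) a b :
  In formula T (And a b) <-> In formula T a /\ In formula T b.
Proof. rewrite !prime_mem. apply derives_and. Qed.

Lemma prime_or (T : prime_theory) a b :
  In formula T (Or a b) <-> In formula T a \/ In formula T b.
Proof.
  split; [apply prime_disjunction|]. rewrite !prime_mem.
  intros [Ha|Hb]; [now apply derives_or_l|now apply derives_or_r].
Qed.

Lemma prime_imp (T : prime_theory) a b :
  In formula T (Imp a b) <->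
  forall U : prime_theory,
    Included formula T U -> In formula U a -> In formula U b.
Proof.
  split.
  - intros Hab U HTU Ha. apply prime_closed, (d_mp _ a); apply d_hyp; auto.
  - intros HU. apply prime_closed, deduction, NNPP. intros Hb.
    destruct (prime_extension_formula _ _ Hb) as (U & HTU & HUb).
    apply HUb, HU.
    + intros c Hc. apply HTU. now left.
    + apply HTU. right. constructor.
Qed.

Lemma directed_prime (T : prime_theory) : directed (transp formula entails) T.
Proof.
  split.
  - exists (Imp Bot Bot). apply prime_closed, derives_id.
  - intros a b Ha Hb. exists (And a b).
    split; [now apply prime_and|].
    apply derives_and, entails_refl.
Qed.

Lemma directed_prime_complement (T : prime_theory) :
  directed entails (Complement formula T).
Proof.
  split.
  - exists Bot. apply prime_consistent.
  - intros a b Ha Hb. exists (Or a b). split; [|split].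
    + intros [Ha'|Hb']%prime_or; [exact (Ha Ha')|exact (Hb Hb')].
    + apply derives_or_l, entails_refl.
    + apply derives_or_r, entails_refl.
Qed.

Definition uniting_formulas (x y : theory) : theory := image2 uniting x y.

Definition excluded_disjunctions (x y : theory) : theory :=
  image2 Or (Complement formula x) (Complement formula y).

Lemma uniting_formulas_avoid (w x y : prime_theory) :
  Included formula w x -> Included formula w y ->
  avoids (Union formula w (uniting_formulas x y)) (excluded_disjunctions x y).
Proof.
  intros Hwx Hwy _ [r s Hr Hs] Hrs.
  apply derives_filter_base in Hrs.
  - destruct Hrs as (_ & [p q Hp Hq] & Hrs%derives_su_rule).
    rewrite <- prime_mem, prime_or in Hrs. destruct Hrs as [Hpr|Hqs].
    + exact (Hr (proj1 (prime_imp w p r) Hpr x Hwx Hp)).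
    + exact (Hs (proj1 (prime_imp w q s) Hqs y Hwy Hq)).
  - apply (directed_image2 (transp _ entails) (transp _ entails));
      auto using directed_prime.
    intros p p' q q'. apply entails_uniting.
Qed.

Lemma avoids_excluded_disjunctions (z : theory) (x y : prime_theory) :
  avoids z (excluded_disjunctions x y) ->
  Included formula z x /\ Included formula z y.
Proof.
  intros Hz. split; intros a Ha; apply NNPP; intros Hna.
  - apply (Hz (Or a Bot)); [|now apply derives_or_l, d_hyp].
    constructor; [exact Hna|apply prime_consistent].
  - apply (Hz (Or Bot a)); [|now apply derives_or_r, d_hyp].
    constructor; [apply prime_consistent|exact Hna].
Qed.

Lemma uniting_prime_theory (w x y : prime_theory) :
  Included formula w x -> Included formula w y ->
  exists z : prime_theory,
    Included formula (Union formula w (uniting_formulas x y)) z /\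
    Included formula z x /\ Included formula z y.
Proof.
  intros Hwx Hwy.
  destruct (prime_extension (Union formula w (uniting_formulas x y))
              (excluded_disjunctions x y)) as (z & Hz & Hav).
  - apply (directed_image2 entails entails);
      auto using directed_prime_complement.
    intros r r' s s'. apply entails_or.
  - now apply uniting_formulas_avoid.
  - exists z. split; [exact Hz|]. now apply avoids_excluded_disjunctions.
Qed.

Definition canonical : S4_frame := {|
  world := prime_theory;
  acc S T := Included formula S T;
  acc_refl T a Ha := Ha;
  acc_trans S T U HST HTU a Ha := HTU a (HST a Ha)
|}.

Definition canonical_valuation (n : nat) : Ensemble (world canonical) :=
  fun T => In formula T (Var n).

Lemma canonical_truth (a : formula) (T : prime_theory) :
  forces canonical canonical_valuation T a <-> In formula T a.
Proof.
  revert T.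
  induction a as [n| |a IHa b IHb|a IHa b IHb|a IHa b IHb]; intros T; cbn.
  - reflexivity.
  - split; [intros []|apply prime_consistent].
  - now rewrite IHa, IHb, prime_and.
  - now rewrite IHa, IHb, prime_or.
  - rewrite prime_imp.
    split; intros H U HTU; specialize (H U HTU); now rewrite IHa, IHb in *.
Qed.

Lemma canonical_up_or_diamond (v x y : prime_theory) :
  (forall p q, In formula x p -> In formula y q ->
    In formula v (Imp (Neg q) p)) ->
  In prime_theory
     (Union prime_theory (up canonical (Singleton prime_theory x))
        (diamond canonical (up canonical (Singleton prime_theory y)))) v.
Proof.
  intros Himp.
  destruct (classic (SU_derives (Union formula v y) Bot)) as [Hbot|Hcons].
  - left. exists x. split; [constructor|].
    destruct (derives_filter_base v y Bot (directed_prime y) Hbot)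
      as (q & Hq & Hnq%deduction).
    intros p Hp. apply prime_closed, (d_mp _ (Neg q)); [|exact Hnq].
    now apply d_hyp, Himp.
  - right.
    destruct (prime_extension_formula _ _ Hcons) as (u & Hu & _).
    exists u. split.
    + exists y. split; [constructor|].
      intros a Ha. apply Hu. now right.
    + intros a Ha. apply Hu. now left.
Qed.

Lemma canonical_su2 : su2 canonical.
Proof.
  intros w x y Hwx Hwy.
  destruct (uniting_prime_theory w x y Hwx Hwy) as (z & Hz & Hzx & Hzy).
  assert (Huniting : forall p q, In formula x p -> In formula y q ->
    In formula z (Imp (Neg p) q) /\ In formula z (Imp (Neg q) p)).
  { intros p q Hp Hq. apply prime_and, (Hz (uniting p q)).
    right. now constructor. }
  exists z. split; [intros a Ha; apply Hz; now left|].
  split; [exact Hzx|]. split; [exact Hzy|].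
  split; intros v Hzv; apply canonical_up_or_diamond.
  - intros p q Hp Hq. apply Hzv, (Huniting p q Hp Hq).
  - intros q p Hq Hp. apply Hzv, (Huniting p q Hp Hq).
Qed.

Theorem theorem3 (Gamma : Ensemble formula) (phi : formula) :
  SU_entails Gamma phi -> SU_derives Gamma phi.
Proof.
  intros Hent.
  apply NNPP. intros Hphi.
  destruct (prime_extension_formula Gamma phi Hphi) as (T & HGT & HTphi).
  apply HTphi, canonical_truth, Hent.
  - exact canonical_su2.
  - intros n S U HS HSU. apply HSU, HS.
  - intros a Ha. apply canonical_truth, HGT, Ha.
Qed.
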